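(* Let $\mathfrak{M}_0$ be the unital $*$-algebra generated by the monotone annihilation operators $\{a_i:i\in\mathbb{Z}\}$, and let $$\mathfrak{M}_0^{\rm ex}:=\{X\in\mathfrak{M}_0: T_\sigma(X)=X\ \text{for every }\sigma\in\mathbb{P}_{\mathbb{Z}}\}.$$ Then $\mathfrak{M}_0^{\rm ex}=\mathbb{C}I$.
   Context: For $k\ge 1$ let $I_k=\{(i_1,\dots,i_k)\in\mathbb{Z}^k: i_1<\dots<i_k\}$. The discrete monotone Fock space is $\mathcal{F}_m=\bigoplus_{k\ge 0}\mathcal{H}_k$ with $\mathcal{H}_k=\ell^2(I_k)$ for $k\geq 1$ and $\mathcal{H}_0=\mathbb{C}\zeta$, $\zeta$ a unit vector (the vacuum); its canonical orthonormal basis is $\{\zeta\}\cup\{e_{(i_1,\dots,i_k)}\}$. For $i\in\mathbb{Z}$ the creation operator $a_i^\dagger$ is the bounded operator with $a_i^\dagger\zeta=e_{(i)}$ and $a_i^\dagger e_{(i_1,\dots,i_k)}=e_{(i,i_1,\dots,i_k)}$ if $i<i_1$, and $0$ otherwise. The annihilation operator $a_i$ is its adjoint: $a_i\zeta=0$, $a_ie_{(i_1,\dots,i_k)}=e_{(i_2,\dots,i_k)}$ if $i=i_1$ (with $a_ie_{(i)}=\zeta$), and $0$ otherwise. $\mathfrak{M}_0\subset\mathcal{B}(\mathcal{F}_m)$ is the unital $*$-algebra generated by $\{a_i:i\in\mathbb{Z}\}$. For finite subsets $\lambda_1=\{i_1<\dots<i_m\}$, $\lambda_2=\{j_n<\dots<j_1\}$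 of $\mathbb{Z}$ (possibly empty) put $X_{(\lambda_1,\lambda_2)}=a_ia_i^\dagger$ if $\lambda_1=\lambda_2=\{i\}$, and $X_{(\lambda_1,\lambda_2)}=a_{i_1}^\dagger\cdots a_{i_m}^\dagger a_{j_1}\cdots a_{j_n}$ in all other cases (with $X_{(\emptyset,\emptyset)}=I$). It is known that these elements form a Hamel basis of $\mathfrak{M}_0$. $\mathbb{P}_{\mathbb{Z}}$ is the group of permutations of $\mathbb{Z}$ moving only finitely many elements. For $\sigma\in\mathbb{P}_{\mathbb{Z}}$, $T_\sigma:\mathfrak{M}_0\to\mathfrak{M}_0$ is the linear map with $T_\sigma(X_{(\lambda_1,\lambda_2)})=X_{(\sigma(\lambda_1),\sigma(\lambda_2))}$ if $\sigma$ is strictly increasing on $\lambda_1$ and strictly increasing on $\lambda_2$, and $T_\sigma(X_{(\lambda_1,\lambda_2)})=0$ otherwise. *)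

(* Defs.v *)
From HB Require Import structures.
From mathcomp Require Import all_boot all_order all_algebra finmap.
From mathcomp Require Import all_classical all_reals all_analysis.
From mathcomp Require Import complex ring lra.
From mathcomp Require summability.

Set Implicit Arguments.
Unset Strict Implicit.
Unset Printing Implicit Defensive.

Import Order.TTheory GRing.Theory Num.Theory ComplexField.
Import numFieldNormedType.Exports.

Local Open Scope classical_set_scope.
Local Open Scope ring_scope.

(* The index set is nonempty so that the bounded operators form a nontrivial
   ring. *)
Section SquareSummable.
Variables (R : realType) (I : pointedType).

Definition normsq (x : I -> R[i]) : \bar R :=
  (\esum_(i in [set: I]) ((Normc.normc (x i)) ^+ 2)%:E)%E.

Definition square_summable : {pred I -> R[i]} :=
  fun x => (normsq x < +oo)%E.

Record l2 := L2 { l2_fun :> I -> R[i]; _ : l2_fun \in square_summable }.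

HB.instance Definition _ := [isSub for l2_fun].
HB.instance Definition _ := [Choice of l2 by <:].

Lemma normc_ge0 (z : R[i]) : 0 <= Normc.normc z.
Proof. by case: z => a b; exact: sqrtr_ge0. Qed.

Lemma normsq_ge0 (x : I -> R[i]) : (0 <= normsq x)%E.
Proof. by apply: esum_ge0 => i _; rewrite lee_fin sqr_ge0. Qed.

Lemma normsq0 : normsq 0 = 0%E.
Proof. by apply: esum1 => i _; rewrite Normc.normc0 expr0n. Qed.

Lemma normsqZ_le (c : R[i]) (x : I -> R[i]) :
  (normsq (c *: x)%R <= ((Normc.normc c) ^+ 2)%:E * normsq x)%E.
Proof.
apply: ge_ereal_sup => _ [F [finF _] <-].
rewrite fsbig_finite//= (eq_bigr (fun i =>
  (((Normc.normc c) ^+ 2)%:E * ((Normc.normc (x i)) ^+ 2)%:E)%E)); last first.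
  by move=> i _; rewrite -EFinM -exprMn -Normc.normcM.
rewrite -ge0_sume_distrr; last by move=> i _; rewrite lee_fin sqr_ge0.
apply: lee_wpmul2l; first by rewrite lee_fin sqr_ge0.
by apply: ereal_sup_ubound; exists F => //; rewrite fsbig_finite.
Qed.

Lemma normsqD_le (x y : I -> R[i]) :
  (normsq (x + y)%R <= 2%:E * normsq x + 2%:E * normsq y)%E.
Proof.
apply: ge_ereal_sup => _ [F [finF _] <-].
rewrite fsbig_finite//=.
apply: (@le_trans _ _ (\sum_(i <- fset_set F)
  (2%:E * ((Normc.normc (x i)) ^+ 2)%:E +
   2%:E * ((Normc.normc (y i)) ^+ 2)%:E))%E).
  apply: lee_sum => i _; rewrite -!EFinM -EFinD lee_fin.
  have cab : Normc.normc ((x + y) i) <=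
      Normc.normc (x i) + Normc.normc (y i) := le_normcD _ _.
  have c0 := normc_ge0 ((x + y) i).
  apply: (@le_trans _ _ ((Normc.normc (x i) + Normc.normc (y i)) ^+ 2)).
    by rewrite ler_pXn2r// nnegrE// (le_trans c0).
  move: (Normc.normc (x i)) (Normc.normc (y i)) => a b.
  by have := sqr_ge0 (a - b); nra.
rewrite big_split/= -!ge0_sume_distrr; try by
  move=> i _; rewrite lee_fin sqr_ge0.
by apply: leeD; apply: lee_wpmul2l; rewrite ?lee_fin//;
  apply: ereal_sup_ubound; exists F => //; rewrite fsbig_finite.
Qed.

Lemma square_summable_submod_closed : submod_closed square_summable.
Proof.
split; first by rewrite unfold_in normsq0 ltry.
move=> c x y; rewrite !unfold_in => xoo yoo.
apply: (le_lt_trans (normsqD_le _ _)); apply: lte_add_pinfty.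
  apply: lte_mul_pinfty => //.
  apply: (le_lt_trans (normsqZ_le _ _)); apply: lte_mul_pinfty => //.
  by rewrite lee_fin sqr_ge0.
by apply: lte_mul_pinfty.
Qed.

HB.instance Definition _ := GRing.isSubmodClosed.Build _ _ square_summable
  square_summable_submod_closed.
HB.instance Definition _ := [SubChoice_isSubLmodule of l2 by <:].

Definition norm_l2 (x : l2) : R := Num.sqrt (fine (normsq x)).

Lemma normsq_l2E (x : l2) : normsq x = ((norm_l2 x) ^+ 2)%:E.
Proof.
have := valP x; rewrite unfold_in /= => xoo.
have x0 := normsq_ge0 x.
by rewrite /norm_l2 sqr_sqrtr ?fine_ge0// fineK// ge0_fin_numE.
Qed.

(* Linear in the first argument. [summability.sum] is the unconditional sum,
   i.e., the limit of the partial sums along the net of the finite subsets of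
   I. *)
Definition inner (x y : l2) : R[i] :=
  summability.sum (fun i => x i * (y i)^* : R[i]^o).

Definition bounded_operator : {pred l2 -> l2} := fun A =>
  `[< linear A /\ exists M : R, forall x, norm_l2 (A x) <= M * norm_l2 x >].

Record bop := BOp { bop_fun :> l2 -> l2; _ : bop_fun \in bounded_operator }.

HB.instance Definition _ := [isSub for bop_fun].
HB.instance Definition _ := [Choice of bop by <:].

Lemma bounded_operatorP (A : l2 -> l2) :
  A \in bounded_operator <-> (linear A /\ exists2 M : R, 0 <= M &
    forall x, (normsq (A x) <= M%:E * normsq x)%E).
Proof.
rewrite unfold_in; split=> [/asboolP[lA [M AM]]|[lA [M M0 AM]]].
  split => //; exists (M ^+ 2); first exact: sqr_ge0.
  move=> x; rewrite !normsq_l2E -EFinM lee_fin -exprMn.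
  have := AM x; have : 0 <= norm_l2 (A x) by exact: sqrtr_ge0.
  nra.
apply/asboolP; split=> //; exists (Num.sqrt M) => x.
rewrite /norm_l2 -sqrtrM// ler_wsqrtr//.
by have := AM x; rewrite !normsq_l2E -EFinM.
Qed.

Lemma bounded_operator_submod_closed : submod_closed bounded_operator.
Proof.
split.
  apply/bounded_operatorP; split; first by move=> c x y; rewrite scaler0 addr0.
  by exists 0 => // x; rewrite mul0e normsq0.
move=> c A B /bounded_operatorP[lA [M M0 AM]] /bounded_operatorP[lB [N N0 BN]].
apply/bounded_operatorP; split.
  move=> k x y; rewrite !fctE lA lB !scalerDr !scalerA (mulrC k) -!addrA.
  by congr (_ + _); rewrite addrCA.
exists (2 * (Normc.normc c ^+ 2 * M) + 2 * N) => [|x].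
  by apply: addr_ge0; rewrite mulr_ge0 ?ler0n ?mulr_ge0 ?exprn_ge0 ?normc_ge0.
rewrite EFinD ge0_muleDl ?lee_fin ?mulr_ge0 ?ler0n ?exprn_ge0 ?normc_ge0//.
apply: (le_trans (normsqD_le _ _)); apply: leeD.
  rewrite EFinM -muleA; apply: lee_wpmul2l; rewrite ?lee_fin//.
  apply: (le_trans (normsqZ_le _ _)); rewrite (EFinM _ M) -muleA.
  by apply: lee_wpmul2l; rewrite ?lee_fin ?sqr_ge0.
by rewrite EFinM -muleA; apply: lee_wpmul2l; rewrite ?lee_fin.
Qed.

HB.instance Definition _ := GRing.isSubmodClosed.Build _ _ bounded_operator
  bounded_operator_submod_closed.
HB.instance Definition _ := [SubChoice_isSubLmodule of bop by <:].

Lemma bop_linear (A : bop) : linear A.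
Proof. by have /bounded_operatorP[] := valP A. Qed.

HB.instance Definition _ (A : bop) :=
  GRing.isLinear.Build R[i] l2 l2 _ (bop_fun A) (bop_linear A).

Lemma bop1_subproof : idfun \in bounded_operator.
Proof. by apply/bounded_operatorP; split => //; exists 1 => // x; rewrite mul1e. Qed.

Lemma bopM_subproof (A B : bop) : A \o B \in bounded_operator.
Proof.
have /bounded_operatorP[lA [M M0 AM]] := valP A.
have /bounded_operatorP[lB [N N0 BN]] := valP B.
apply/bounded_operatorP; split; first by move=> c x y /=; rewrite lB lA.
exists (M * N) => [|x]; first exact: mulr_ge0.
apply: (le_trans (AM _)); rewrite EFinM -muleA.
by apply: lee_wpmul2l; rewrite ?lee_fin.
Qed.

Definition bop1 : bop := BOp bop1_subproof.
Definition bopM (A B : bop) : bop := BOp (bopM_subproof A B).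

Lemma bopP (A B : bop) : A =1 B -> A = B.
Proof. by move=> AB; apply/val_inj/funext. Qed.

Lemma bopMA : associative bopM. Proof. by move=> A B D; apply: bopP. Qed.
Lemma bopM1l : left_id bop1 bopM. Proof. by move=> A; apply: bopP. Qed.
Lemma bopM1r : right_id bop1 bopM. Proof. by move=> A; apply: bopP. Qed.
Lemma bopMDl : left_distributive bopM +%R.
Proof. by move=> A B D; apply: bopP. Qed.
Lemma bopMDr : right_distributive bopM +%R.
Proof. by move=> A B D; apply: bopP => x; exact: linearD. Qed.

Lemma basis_subproof (i : I) :
  (fun j => (j == i)%:R : R[i]) \in square_summable.
Proof.
rewrite unfold_in /normsq esum_mkcond.
rewrite (_ : esum _ _ = \esum_(j in [set i]) 1%:E)%E; last first.
  rewrite [RHS]esum_mkcond; apply: eq_esum => j _.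
  rewrite in_setT; case: ifPn; rewrite ?inE /=.
    by move->; rewrite eqxx Normc.normc1 expr1n.
  by rewrite notin_setE/= => /eqP/negbTE ->; rewrite Normc.normc0 expr0n.
by rewrite esum_set1 ?lee_fin// ltry.
Qed.

Definition basis (i : I) : l2 := L2 (basis_subproof i).

Lemma bop1_neq0 : bop1 != 0.
Proof.
apply/eqP => /(congr1 (fun A : bop => A (basis point) point)) /= /eqP.
by rewrite eqxx oner_eq0.
Qed.

HB.instance Definition _ := GRing.Zmodule_isNzRing.Build bop
  bopMA bopM1l bopM1r bopMDl bopMDr bop1_neq0.

Lemma bop_scalerAl (c : R[i]) (A B : bop) : c *: (A * B) = (c *: A) * B.
Proof. by apply: bopP. Qed.
HB.instance Definition _ := GRing.Lmodule_isLalgebra.Build _ bop bop_scalerAl.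

Lemma bop_scalerAr (c : R[i]) (A B : bop) : c *: (A * B) = A * (c *: B).
Proof. by apply: bopP => x; apply/esym; exact: linearZ. Qed.
HB.instance Definition _ := GRing.Lalgebra_isAlgebra.Build _ bop bop_scalerAr.

Definition adjoint (A B : bop) := forall x y, inner (A x) y = inner x (B y).

(* [adjoint A B] means that B is the adjoint of A, so the last clause is the
   closure of S under the involution of B(l^2(I)). *)
Definition unital_star_subalgebra (S : set bop) :=
  [/\ S 1,
      forall (c : R[i]) A B, S A -> S B -> S (c *: A + B),
      forall A B, S A -> S B -> S (A * B) &
      forall A B, S A -> adjoint A B -> S B].

Definition star_algebra_generated (G : set bop) : set bop :=
  smallest unital_star_subalgebra G.

Lemma star_algebra_generatedP (G : set bop) :
  unital_star_subalgebra (star_algebra_generated G).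
Proof.
split.
- by move=> S [[]].
- move=> c A B SA SB S SP; have [_ + _ _] := SP.1.
  by apply; [apply: SA|apply: SB].
- move=> A B SA SB S SP; have [_ _ + _] := SP.1.
  by apply; [apply: SA|apply: SB].
- move=> A B SA AB S SP; have [_ _ _ +] := SP.1.
  by apply; [apply: SA|].
Qed.

End SquareSummable.

Arguments basis R {I} i.

(* The index set of the canonical basis: strictly increasing finite sequences
   of integers. The sequences of length k form I_k, and the empty sequence is
   the index of the vacuum, so that l2 of this type is the Hilbert direct sum
   of C and of the l^2(I_k) for k >= 1. *)
Record mono := Mono { mono_seq :> seq int; _ : sorted <%R mono_seq }.

HB.instance Definition _ := [isSub for mono_seq].
HB.instance Definition _ := [Choice of mono by <:].

Definition mono0 : mono := @Mono [::] isT.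
HB.instance Definition _ := isPointed.Build mono mono0.

Lemma mono_tail_subproof (s : mono) : sorted <%R (behead s).
Proof. by case: s => -[|i [|j s]]//= /andP[]. Qed.

Definition mono_tail (s : mono) : mono := Mono (mono_tail_subproof s).

(* [None] when i :: s is not strictly increasing *)
Definition mono_cons (i : int) (s : mono) : option mono := insub (i :: s).

Section PartialReindexing.
Variables (R : realType) (I : pointedType) (h : I -> option I).
Hypothesis h_inj : forall i j k, h i = Some k -> h j = Some k -> i = j.

Definition reindex_fun (x : I -> R[i]) : I -> R[i] :=
  fun i => oapp x 0 (h i).

Lemma normsq_reindex (x : I -> R[i]) :
  (normsq (reindex_fun x) <= normsq x)%E.
Proof.
pose a i := ((Normc.normc (x i)) ^+ 2)%:E.
pose D := [set i | h i != None].
pose g i := odflt point (h i).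
have a0 i : (0 <= a i)%E by rewrite lee_fin sqr_ge0.
rewrite /normsq (_ : esum _ _ = \esum_(i in D) a (g i))%E; last first.
  rewrite [RHS]esum_mkcond; apply: eq_esum => i _.
  rewrite /reindex_fun /D /g; case: ifPn; rewrite ?inE ?notin_setE/=.
    by case: (h i).
  case: (h i) => [k|] hk; first by case: hk.
  by rewrite -[oapp _ _ _]/(0 : R[i]) Normc.normc0 expr0n.
rewrite -(@esum_image _ _ _ D g a); last first.
  move=> i j; rewrite !inE /D /g /=.
  case hi: (h i) => [k|]// _; case hj: (h j) => [l|]//= _ kl.
  by apply: (h_inj hi); rewrite kl.
rewrite esum_mkcond; apply: le_esum => i _; case: ifP => // _; exact: a0.
Qed.

Lemma reindex_subproof (x : l2 R I) : reindex_fun x \in @square_summable R I.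
Proof.
by have := valP x; rewrite !unfold_in; apply: le_lt_trans; exact: normsq_reindex.
Qed.

Definition reindex_l2 (x : l2 R I) : l2 R I := L2 (reindex_subproof x).

Lemma reindex_bop_subproof : reindex_l2 \in @bounded_operator R I.
Proof.
apply/bounded_operatorP; split.
  move=> c x y; apply/val_inj/funext => i.
  rewrite -[LHS]/(oapp (c *: (x : I -> R[i]) + (y : I -> R[i])) 0 (h i)).
  rewrite -[RHS]/(c *: oapp x 0 (h i) + oapp y 0 (h i)).
  by case: (h i) => [k|] //; rewrite /= scaler0 addr0.
by exists 1 => // x; rewrite mul1e; exact: normsq_reindex.
Qed.

(* the partial isometry with (A x)_i = x_(h i), and 0 where h is undefined *)
Definition reindex_op : bop R I := BOp reindex_bop_subproof.

End PartialReindexing.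

Section PartialBijection.
Variables (R : realType) (I : pointedType) (h h' : I -> option I).
Hypothesis h_inj : forall i j k, h i = Some k -> h j = Some k -> i = j.
Hypothesis h'_inj : forall i j k, h' i = Some k -> h' j = Some k -> i = j.
Hypothesis hh' : forall i k, h i = Some k <-> h' k = Some i.

Lemma reindex_basis (s : I) :
  reindex_op R h_inj (basis R s) = oapp (basis R) 0 (h' s).
Proof.
apply/val_inj/funext => t.
rewrite -[LHS]/(oapp (fun j => (j == s)%:R) 0 (h t)).
have -> : oapp (fun j => (j == s)%:R) 0 (h t) = (h t == Some s)%:R :> R[i].
  by case: (h t).
have -> : (h t == Some s) = (h' s == Some t) by apply/eqP/eqP => /hh'.
case: (h' s) => [u|] //.
by rewrite -[RHS]/((t == u)%:R) eq_sym.
Qed.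

End PartialBijection.

Section SumReindex.
Variables (V : zmodType) (I : choiceType).
Implicit Types (h : I -> option I) (F : I -> I -> V).
Import summability.

Let partial_sum_reindex h h' F (S : set V) :
  (forall i k, h i = Some k <-> h' k = Some i) ->
  nbhs (partial_sum (fun i => oapp (F i) 0 (h i)) @ totally) S ->
  nbhs (partial_sum (fun k => oapp (fun i => F i k) 0 (h' k)) @ totally) S.
Proof.
move=> hh' [A _ AS].
exists [fset k in pmap h A]%fset => // B /= /fsubsetP AB.
pose B' := (A `|` [fset i in pmap h' B])%fset.
suff -> : partial_sum (fun k => oapp (fun i => F i k) 0 (h' k)) B =
          partial_sum (fun i => oapp (F i) 0 (h i)) B'.
  by apply: AS; rewrite /= fsubsetUl.
have psE f (D : {fset I}) : partial_sum f D = \sum_(i <- D) f i :> V.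
  by rewrite /partial_sum big_seq_fsetE.
rewrite !psE.
transitivity (\sum_(k <- B) \sum_(i <- B') if h i == Some k then F i k else 0).
  apply: eq_big_seq => k kB; case h'k : (h' k) => [i|] /=.
    have iB' : i \in B'.
      by rewrite !inE mem_pmap; apply/orP; right; apply/mapP; exists k.
    rewrite (bigD1_seq i)//= (proj2 (hh' i k) h'k) eqxx big1 ?addr0// => j /eqP ji.
    case: eqP => // /hh'; rewrite h'k => -[ij].
    by case: ji.
  by rewrite big1// => i _; case: eqP => // /hh'; rewrite h'k.
rewrite exchange_big; apply: eq_big_seq => i iB'.
case hi : (h i) => [k|] /=; last by rewrite big1.
have kB : k \in B.
  move: iB'; rewrite !inE mem_pmap => /orP[iA|/mapP[l lB]].
    by apply: AB; rewrite inE mem_pmap; apply/mapP; exists i.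
  by move=> /esym/hh'; rewrite hi => -[->].
rewrite (bigD1_seq k)//= eqxx big1 ?addr0// => l lk.
by case: eqP => // -[kl]; rewrite kl eqxx in lk.
Qed.

Lemma partial_sum_reindexE h h' F :
  (forall i k, h i = Some k <-> h' k = Some i) ->
  partial_sum (fun i => oapp (F i) 0 (h i)) @ totally =
  partial_sum (fun k => oapp (fun i => F i k) 0 (h' k)) @ totally.
Proof.
move=> hh'; apply/seteqP; split => S.
  exact: partial_sum_reindex.
by apply: (@partial_sum_reindex h' h (fun k i => F i k)) => i k; split => /hh'.
Qed.

End SumReindex.

Section ReindexAdjoint.
Variables (R : realType) (I : pointedType) (h h' : I -> option I).
Hypothesis h_inj : forall i j k, h i = Some k -> h j = Some k -> i = j.
Hypothesis h'_inj : forall i j k, h' i = Some k -> h' j = Some k -> i = j.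
Hypothesis hh' : forall i k, h i = Some k <-> h' k = Some i.

Lemma reindex_adjoint : adjoint (reindex_op R h_inj) (reindex_op R h'_inj).
Proof.
move=> x y; rewrite /inner /summability.sum.
have := @partial_sum_reindexE R[i]^o I h h' (fun i k => x k * (y i)^*) hh'.
set f := (X in summability.partial_sum X @ _ = _).
set g := (X in _ = summability.partial_sum X @ _) => fg.
rewrite (_ : (fun i => _) = f); last first.
  apply/funext => i; rewrite /f -[LHS]/(oapp x 0 (h i) * (y i)^*).
  by case: (h i) => //=; rewrite mul0r.
rewrite fg (_ : g = (fun k => x k * (reindex_op R h'_inj y k)^*))//.
apply/funext => k; rewrite /g -[RHS]/(x k * (oapp y 0 (h' k))^*).
by case: (h' k) => //=; rewrite conjC0 mulr0.
Qed.

End ReindexAdjoint.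

Definition create_index (i : int) (s : mono) : option mono :=
  if ohead s == Some i then Some (mono_tail s) else None.

Lemma create_index_inj (i : int) s t u :
  create_index i s = Some u -> create_index i t = Some u -> s = t.
Proof.
rewrite /create_index; case: eqP => // si [<-]; case: eqP => // ti [st].
apply: val_inj; case: s t si ti st => -[|a s] ? [[|b t] ?]//= [->] [->] ->.
by [].
Qed.

Lemma mono_consP (i : int) s t :
  create_index i t = Some s <-> mono_cons i s = Some t.
Proof.
rewrite /create_index /mono_cons; split.
  case: eqP => // ti [<-]; rewrite (_ : i :: _ = val t) ?valK//.
  by case: t ti => -[|a t] ?//= [->].
case: insubP => // u _ + [ut]; rewrite {}ut => tE.
have -> : ohead t == Some i by case: t tE => /= ? ? ->.
by congr Some; apply: val_inj; case: t tE => /= ? ? ->.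
Qed.

Lemma mono_cons_inj (i : int) s t u :
  mono_cons i s = Some u -> mono_cons i t = Some u -> s = t.
Proof. by move=> /mono_consP us /mono_consP; rewrite us => -[]. Qed.

Section Fock.
Variable R : realType.

Definition fock := l2 R mono. (* the vacuum is basis R mono0 *)
Definition bfock := bop R mono.

(* (a_i^dagger x)_(i :: s) = x_s, all the other coordinates being 0 *)
Definition creation (i : int) : bfock :=
  reindex_op R (@create_index_inj i).

(* (a_i x)_s = x_(i :: s) if i :: s is increasing, and 0 otherwise *)
Definition annihilation (i : int) : bfock :=
  reindex_op R (@mono_cons_inj i).

Lemma creation_basis (i : int) (s : mono) :
  creation i (basis R s) = oapp (basis R) 0 (mono_cons i s).
Proof.
by apply: reindex_basis => t u; exact: mono_consP.
Qed.

Lemma annihilation_basis (i : int) (s : mono) :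
  annihilation i (basis R s) = oapp (basis R) 0 (create_index i s).
Proof.
by apply: reindex_basis => t u; split => /mono_consP.
Qed.

Lemma adjoint_creation (i : int) : adjoint (creation i) (annihilation i).
Proof.
by apply: reindex_adjoint => t u; exact: mono_consP.
Qed.

Lemma adjoint_annihilation (i : int) : adjoint (annihilation i) (creation i).
Proof.
by apply: reindex_adjoint => t u; split => /mono_consP.
Qed.

Definition monotone_star_algebra : set bfock :=
  star_algebra_generated (range annihilation).

Definition in_M0 : {pred bfock} := fun A => `[< monotone_star_algebra A >].

Lemma in_M0_subalg_closed : subalg_closed in_M0.
Proof.
have [S1 SD SM _] := star_algebra_generatedP (range annihilation).
split; first exact/asboolP.
- by move=> c A B /asboolP SA /asboolP SB; apply/asboolP; exact: SD.
- by move=> A B /asboolP SA /asboolP SB; apply/asboolP; exact: SM.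
Qed.

HB.instance Definition _ := GRing.isSubalgClosed.Build R[i] bfock in_M0
  in_M0_subalg_closed.

Record M0 := M0Sub { M0_val :> bfock; _ : M0_val \in in_M0 }.

HB.instance Definition _ := [isSub for M0_val].
HB.instance Definition _ := [Choice of M0 by <:].
HB.instance Definition _ := [SubChoice_isSubAlgebra of M0 by <:].

Lemma annihilation_M0 (i : int) : annihilation i \in in_M0.
Proof. by apply/asboolP; apply: sub_gen_smallest; exists i. Qed.

Lemma creation_M0 (i : int) : creation i \in in_M0.
Proof.
have [_ _ _ SA] := star_algebra_generatedP (range annihilation).
apply/asboolP; apply: SA (adjoint_annihilation i).
by have /asboolP := annihilation_M0 i.
Qed.

Definition an (i : int) : M0 := M0Sub (annihilation_M0 i).
Definition cr (i : int) : M0 := M0Sub (creation_M0 i).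

Definition creations (l : {fset int}) : M0 :=
  \prod_(i <- sort <=%R l) cr i.
Definition annihilations (l : {fset int}) : M0 :=
  \prod_(j <- rev (sort <=%R l)) an j.

(* The first case is l1 = l2 = {i}, and its value is a_i a_i^dagger, see
   [XbasisE1]. *)
Definition Xbasis (l1 l2 : {fset int}) : M0 :=
  if (l1 == l2) && (#|` l1| == 1)%N then annihilations l2 * creations l1
  else creations l1 * annihilations l2.

Lemma XbasisE1 (i : int) : Xbasis [fset i]%fset [fset i]%fset = an i * cr i.
Proof.
have E : [fset i]%fset = [:: i] :> seq int.
  by apply/perm_small_eq => //; apply: uniq_perm => [|//|j];
    rewrite ?fset_uniq ?inE.
by rewrite /Xbasis eqxx cardfs1/= /annihilations /creations E !big_seq1.
Qed.

Lemma XbasisE0 : Xbasis fset0 fset0 = 1.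
Proof.
have E : fset0 = [::] :> seq int by apply/nilP; rewrite /nilp cardfs0.
rewrite /Xbasis cardfs0 andbF /creations /annihilations E.
by rewrite !big_nil mulr1.
Qed.

Definition finitary_perm (sigma : int -> int) : Prop :=
  bijective sigma /\ finite_set [set i | sigma i != i].

Definition increasing_on (sigma : int -> int) (l : {fset int}) : bool :=
  `[< {in l &, {homo sigma : i j / i < j}} >].

Definition permutes_Xbasis (sigma : int -> int) (T : {linear M0 -> M0}) : Prop :=
  forall l1 l2 : {fset int}, T (Xbasis l1 l2) =
    if increasing_on sigma l1 && increasing_on sigma l2
    then Xbasis (sigma @` l1)%fset (sigma @` l2)%fset else 0.

(* The linear map prescribed on the Hamel basis [Xbasis]; the junk value \0
   would only be taken if there were no such map. *)
Definition Tsigma (sigma : int -> int) : {linear M0 -> M0} :=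
  if pselect (exists T, permutes_Xbasis sigma T) is left exT
  then projT1 (cid exT) else \0.

Definition M0ex : set M0 :=
  [set A | forall sigma, finitary_perm sigma -> Tsigma sigma A = A].

End Fock.

Arguments M0ex R : clear implicits.

(* Main.v *)
From HB Require Import structures.
Require Import Defs.
From mathcomp Require Import all_boot all_order all_algebra finmap.
From mathcomp Require Import all_classical all_reals all_analysis.
From mathcomp Require Import complex zify.
From mathcomp Require summability.

(** An exchangeable element is a finite combination of the elements X indexed
    by pairs of finite sets of integers. A permutation that carries a large
    block [-N, N] increasingly onto a disjoint block replaces every pair of
    sets other than the pair of empty sets by one that did not occur before.
    The elements X being independent, invariance forces all the coefficients
    to vanish except that of the identity.

    For this one needs the elements X to be a Hamel basis; that is also what
    makes the maps [Tsigma] exist ([linear_extension], [Tsigma_permutes]).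

    Spanning ([spans_basisX]). Let [gtproj i] be the product of annihilation
    and creation at [i]: it is the projection onto the vacuum and the basis
    vectors whose first index exceeds [i]. Every product of generators reduces
    to words in normal form (creators on the left, annihilators on the right)
    and to projections [gtproj i], through the annihilating relations, the
    absorption of a projection by a creator or annihilator whose index lies on
    the right side of its threshold, and the relation [gtproj_succ] that moves
    the threshold by one unit. Hence the span is stable under products. It is
    stable under adjoints because the adjoint of a word is a word; the adjoint
    of a combination is found from its matrix.

    Independence ([independent_basisX]). Matrix entries at [(u, v)] count the
    words whose creators and annihilators are obtained from [u] and [v] by
    deleting a common suffix. Subtracting from this entry the one where the
    common last index has been deleted leaves only the word with creators [u]
    and annihilators [v]. For [u = v = [:: m]] this difference takes the value
    [-1] on the projections [gtproj i] with [m <= i], so that one more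
    difference, in [m], isolates a single projection. *)

Set Implicit Arguments.
Unset Strict Implicit.
Unset Printing Implicit Defensive.

Import Order.TTheory GRing.Theory Num.Theory.
Import numFieldNormedType.Exports.

Local Open Scope classical_set_scope.
Local Open Scope ring_scope.

(* topology has a notion of the same name *)
Local Notation basis := Defs.basis.

(** * Linear combinations of a family of vectors *)

Section LinearExtension.
Variables (K : nzRingType) (P : eqType) (V : lmodType K).
Implicit Types (g X : P -> V) (s : seq (K * P)) (p : P).

(** Indices may be repeated along [s], so that concatenation is addition;
    [coef] collects the coefficients of each index. *)
Definition lincomb g s : V := \sum_(cp <- s) cp.1 *: g cp.2.
Definition coef s p : K := \sum_(cp <- s | cp.2 == p) cp.1.

Definition in_span X A := exists s, A = lincomb X s.
Definition spans X := forall A, in_span X A.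
Definition independent X :=
  forall s, lincomb X s = 0 -> forall p, coef s p = 0.

Lemma lincomb_cat g s t : lincomb g (s ++ t) = lincomb g s + lincomb g t.
Proof. exact: big_cat. Qed.

Lemma coef_cat s t p : coef (s ++ t) p = coef s p + coef t p.
Proof. exact: big_cat. Qed.

Definition scale_seq c s : seq (K * P) := [seq (c * cp.1, cp.2) | cp <- s].

Lemma lincomb_scale g c s : lincomb g (scale_seq c s) = c *: lincomb g s.
Proof.
rewrite /lincomb big_map scaler_sumr.
by apply: eq_bigr => cp _; rewrite scalerA.
Qed.

Lemma coef_scale c s p : coef (scale_seq c s) p = c * coef s p.
Proof. by rewrite /coef big_map mulr_sumr. Qed.

Lemma coef_notin s p : p \notin [seq cp.2 | cp <- s] -> coef s p = 0.
Proof.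
move=> ps; rewrite /coef big_seq_cond big_pred0// => cp.
by apply/negbTE; apply: contra ps => /andP[cps /eqP <-]; apply: map_f.
Qed.

Lemma lincombE g s :
  lincomb g s = \sum_(p <- undup [seq cp.2 | cp <- s]) coef s p *: g p.
Proof.
rewrite /coef; under eq_bigr do rewrite scaler_suml big_mkcond.
rewrite exchange_big; apply: eq_big_seq => cp cps.
rewrite (bigD1_seq cp.2) ?undup_uniq ?mem_undup ?map_f//= eqxx.
rewrite big1 ?addr0// => p /negbTE; rewrite eq_sym => -> //.
Qed.

Lemma in_span_vec X p : in_span X (X p).
Proof. by exists [:: (1, p)]; rewrite /lincomb big_seq1 scale1r. Qed.

Lemma in_span0 X : in_span X 0.
Proof. by exists [::]; rewrite /lincomb big_nil. Qed.

Lemma in_span_lin X c A B :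
  in_span X A -> in_span X B -> in_span X (c *: A + B).
Proof.
move=> [s ->] [t ->]; exists (scale_seq c s ++ t).
by rewrite lincomb_cat lincomb_scale.
Qed.

Lemma in_spanB X A B : in_span X A -> in_span X B -> in_span X (A - B).
Proof. by move=> sA sB; rewrite addrC -scaleN1r; exact: in_span_lin. Qed.

Lemma in_span_map X (f : V -> V) s : linear f ->
  (forall p, in_span X (f (X p))) -> in_span X (f (lincomb X s)).
Proof.
move=> lf sf; rewrite /lincomb; elim: s => [|[c p] s IH].
  have := lf (-1) 0 0; rewrite big_nil !scaler0 addr0 scaleN1r addNr => ->.
  exact: in_span0.
by rewrite big_cons lf; exact: in_span_lin.
Qed.

Lemma eq_coef_lincomb g s t : coef s =1 coef t -> lincomb g s = lincomb g t.
Proof.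
move=> st; suff : lincomb g (s ++ scale_seq (-1) t) = 0.
  by rewrite lincomb_cat lincomb_scale scaleN1r => /subr0_eq.
rewrite lincombE big1// => p _.
by rewrite coef_cat coef_scale st mulN1r subrr scale0r.
Qed.

Lemma lincomb_single g s p0 : (forall p, p != p0 -> coef s p = 0) ->
  lincomb g s = coef s p0 *: g p0.
Proof.
move=> s0; rewrite -[RHS](_ : lincomb g [:: (coef s p0, p0)] = _).
  apply: eq_coef_lincomb => p; rewrite [RHS]/coef big_mkcond big_seq1 /= eq_sym.
  by case: eqVneq => [->|/s0].
by rewrite /lincomb big_seq1.
Qed.

Lemma dual_coef_eq0 (f : V -> K) X p s :
    (forall c A B, f (c *: A + B) = c * f A + f B) ->
    (forall q, f (X q) = (q == p)%:R) ->
  lincomb X s = 0 -> coef s p = 0.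
Proof.
move=> f_linear fX.
have f0 : f 0 = 0.
  by have := f_linear (-1) 0 0; rewrite scaler0 addr0 mulN1r addNr.
suff <- : f (lincomb X s) = coef s p by move=> ->.
rewrite /lincomb /coef; elim: s => [|[c q] s IH]; first by rewrite !big_nil.
rewrite !big_cons f_linear IH fX /=; case: eqP => _; first by rewrite mulr1.
by rewrite mulr0 add0r.
Qed.

Lemma independent_coef X : independent X -> forall s t,
  lincomb X s = lincomb X t -> coef s =1 coef t.
Proof.
move=> Xfree s t st p.
have := Xfree (s ++ scale_seq (-1) t).
rewrite lincomb_cat lincomb_scale scaleN1r st subrr => /(_ erefl p).
by rewrite coef_cat coef_scale mulN1r => /subr0_eq.
Qed.

Lemma linear_lincomb (W : lmodType K) (T : {linear V -> W}) g s :
  T (lincomb g s) = \sum_(cp <- s) cp.1 *: T (g cp.2).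
Proof. by rewrite linear_sum; apply: eq_bigr => cp _; rewrite linearZ. Qed.

(** Choosing an expression of each vector in terms of [X] gives a linear map,
    because independence makes the coefficients of that expression unique. *)
Lemma linear_extension X : independent X -> spans X ->
  forall g, exists T : {linear V -> V}, forall p, T (X p) = g p.
Proof.
move=> Xfree Xspan g.
pose s A := projT1 (cid (Xspan A)).
have sE A : A = lincomb X (s A) by exact: projT2 (cid (Xspan A)).
pose f A := lincomb g (s A).
have f_linear : linear f.
  move=> c A B; rewrite /f -lincomb_scale -lincomb_cat; apply: eq_coef_lincomb.
  apply: (independent_coef Xfree).
  by rewrite lincomb_cat lincomb_scale -!sE.
pose T : {linear V -> V} := HB.pack f (GRing.isLinear.Build K V V _ f f_linear).
exists T => p; rewrite -[LHS]/(f (X p)).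
have -> : f (X p) = lincomb g [:: (1, p)].
  apply: eq_coef_lincomb; apply: (independent_coef Xfree).
  by rewrite -sE /lincomb big_seq1 scale1r.
by rewrite /lincomb big_seq1 scale1r.
Qed.

End LinearExtension.

(** * The action of words on coordinates *)

Definition M0_fun (R : realType) (A : M0 R) : l2 R mono -> l2 R mono :=
  bop_fun (M0_val A).
Coercion M0_fun : M0 >-> Funclass.

Section Words.
Variable R : realType.
Local Notation M0 := (M0 R).
Implicit Types (p q w : seq int) (u v : mono) (i j : int) (x : l2 R mono).

Lemma M0P (A B : M0) : (forall x u, A x u = B x u) -> A = B.
Proof.
by move=> AB; apply/val_inj/bopP => x; apply/val_inj/funext => u; exact: AB.
Qed.

Lemma mulM0E (A B : M0) x u : (A * B) x u = A (B x) u.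
Proof. by []. Qed.

Lemma addM0E (A B : M0) x u : (A + B) x u = A x u + B x u.
Proof. by []. Qed.

Lemma scaleM0E (c : R[i]) (A : M0) x u : (c *: A) x u = c * A x u.
Proof. by []. Qed.

(** The indices of [ans q] are applied in the order of [q]: the head of [q] is
    the first index to be annihilated. Both products vanish unless their
    indices are increasing. *)
Definition crs p : M0 := \prod_(i <- p) cr R i.
Definition ans q : M0 := \prod_(i <- rev q) an R i.

Lemma crs_nil : crs [::] = 1. Proof. exact: big_nil. Qed.
Lemma ans_nil : ans [::] = 1. Proof. exact: big_nil. Qed.
Lemma crs_cons i p : crs (i :: p) = cr R i * crs p. Proof. exact: big_cons. Qed.
Lemma ans_cons i q : ans (i :: q) = ans q * an R i.
Proof. by rewrite /ans rev_cons -cats1 big_cat big_seq1. Qed.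
Lemma ans_rcons i q : ans (rcons q i) = an R i * ans q.
Proof. by rewrite /ans rev_rcons big_cons. Qed.

(** Coordinates extended by 0 to the sequences that are not increasing, so that
    the side condition in the action of [an] disappears. *)
Definition mono_at x w : R[i] := oapp x 0 (insub w : option mono).

Lemma mono_at_val x u : mono_at x (val u) = x u.
Proof. by rewrite /mono_at valK. Qed.

Lemma mono_at_unsorted x w : ~~ sorted <%R w -> mono_at x w = 0.
Proof. by move=> ns; rewrite /mono_at insubN. Qed.

Lemma crE i x u : cr R i x u = if ohead u == Some i then x (mono_tail u) else 0.
Proof. by rewrite -[LHS]/(oapp x 0 (create_index i u)) /create_index; case: ifP. Qed.

Lemma anE i x u : an R i x u = mono_at x (i :: u).
Proof. by []. Qed.

Lemma sorted_catr q w : sorted <%R (q ++ w) -> sorted <%R (w : seq int).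
Proof. by move/(subseq_sorted lt_trans); apply; exact: suffix_subseq. Qed.

Lemma crsE p x u :
  crs p x u = if prefix p u then mono_at x (drop (size p) u) else 0.
Proof.
elim: p u => [|i p IH] u; first by rewrite crs_nil prefix0s drop0 mono_at_val.
rewrite crs_cons mulM0E crE; case: u => -[|j u] us //=.
rewrite -/(Some i) (inj_eq Some_inj) eq_sym; case: eqP => //= _.
Qed.

Lemma ansE q x u : ans q x u = mono_at x (q ++ u).
Proof.
elim: q x u => [|i q IH] x u; first by rewrite ans_nil mono_at_val.
rewrite ans_cons mulM0E IH /=.
have [qu|qu] := boolP (sorted <%R (q ++ u)).
  by rewrite -[q ++ u]/(val (Mono qu)) mono_at_val anE.
rewrite !mono_at_unsorted//; apply: contra qu; exact: (@sorted_catr [:: i]).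
Qed.

Lemma crs_ansE p q x u :
  (crs p * ans q) x u = if prefix p u then mono_at x (q ++ drop (size p) u) else 0.
Proof.
rewrite mulM0E crsE; case: ifP => // _.
have du : sorted <%R (drop (size p) u).
  by apply: (@sorted_catr (take (size p) u)); rewrite cat_take_drop; case: u.
by rewrite -[drop _ _]/(val (Mono du)) mono_at_val ansE.
Qed.

(** The projection onto the span of the vacuum and of the basis vectors whose
    first index is larger than [i]. *)
Definition gtproj i : M0 := an R i * cr R i.

Lemma gtprojE i x u : gtproj i x u = if sorted <%R (i :: u) then x u else 0.
Proof.
rewrite mulM0E anE; case: ifPn => [s|/mono_at_unsorted->//].
rewrite -[i :: u]/(val (Mono s)) mono_at_val crE eqxx; congr (x _).
exact: val_inj.
Qed.

Lemma sorted_catl q w : sorted <%R (q ++ w) -> sorted <%R (q : seq int).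
Proof. by move/(subseq_sorted lt_trans); apply; exact: prefix_subseq. Qed.

Lemma crs_unsorted p : ~~ sorted <%R p -> crs p = 0.
Proof.
move=> ps; apply: M0P => x u; rewrite crsE; case: ifPn => // /prefixP[w uE].
case/negP: ps; apply: (@sorted_catl _ w).
by rewrite -uE; case: u {uE}.
Qed.

Lemma ans_unsorted q : ~~ sorted <%R q -> ans q = 0.
Proof.
move=> qs; apply: M0P => x u; rewrite ansE mono_at_unsorted//.
apply: contra qs; exact: sorted_catl.
Qed.

Lemma mul_an_cr i j : i != j -> an R i * cr R j = 0.
Proof.
move=> ij; apply: M0P => x u; rewrite mulM0E anE.
have [us|/mono_at_unsorted->//] := boolP (sorted <%R (i :: u)).
rewrite -[i :: _]/(val (Mono us)) mono_at_val crE /=.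
by rewrite (inj_eq Some_inj) (negbTE ij).
Qed.

Lemma mul_gtproj_cr i j : i < j -> gtproj i * cr R j = cr R j.
Proof.
move=> ij; apply: M0P => x u; rewrite mulM0E gtprojE crE.
case: ifPn => // iu; case: ifPn => // /eqP uj; case/negP: iu.
by case: u uj => -[//|k u] us [ki]; apply/andP; split; [rewrite ki|exact: us].
Qed.

Lemma mul_gtproj_an i j : i <= j -> gtproj i * an R j = an R j.
Proof.
move=> ij; apply: M0P => x u; rewrite mulM0E gtprojE anE.
case: ifPn => // iu; rewrite mono_at_unsorted//; apply: contra iu.
by case: u => -[//|k u] us /= /andP[jk ->]; rewrite (le_lt_trans ij).
Qed.

Lemma mul_an_gtproj i j : j < i -> an R i * gtproj j = an R i.
Proof.
move=> ji; apply: M0P => x u; rewrite mulM0E !anE.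
have [us|us] := boolP (sorted <%R (i :: u)); last by rewrite !mono_at_unsorted.
rewrite -[i :: _]/(val (Mono us)) !mono_at_val gtprojE ifT//.
by apply/andP; split.
Qed.

Lemma mul_cr_gtproj i j : j <= i -> cr R i * gtproj j = cr R i.
Proof.
move=> ji; apply: M0P => x u; rewrite mulM0E !crE; case: ifPn => // /eqP ui.
rewrite gtprojE; case: ifPn => // ju; case/negP: ju.
case: u ui => -[//|k [//|l u]] us [ki]; have /andP[kl lu] := us.
by apply/andP; split; rewrite ?(le_lt_trans ji)// -ki.
Qed.

(** Lowering the threshold from [i + 1] to [i] adds the basis vectors whose
    first index is [i + 1], on which [cr (i + 1) * an (i + 1)] projects. This
    relation is what keeps all normal forms finite sums. *)
Lemma gtproj_succ i :
  gtproj i = gtproj (i + 1) + cr R (i + 1) * an R (i + 1).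
Proof.
apply: M0P => x u; rewrite addM0E !gtprojE.
rewrite mulM0E crE; case: u => -[|k u] us; first by rewrite addr0.
have sE j : sorted <%R (j :: Mono us) = (j < k).
  by rewrite -[LHS]/((j < k) && path <%R k u) [path _ _ _]us andbT.
rewrite !sE [ohead _]/= (inj_eq Some_inj); case: (ltgtP k (i + 1)) => ki.
- by rewrite ifN ?addr0// -leNgt; lia.
- by rewrite ifT ?addr0//; lia.
- rewrite ifT ?add0r; last by lia.
  by rewrite anE -ki -mono_at_val.
Qed.

End Words.

(** * The elements X span a subalgebra *)

Section Spanning.
Variable R : realType.
Local Notation M0 := (M0 R).
Local Notation cr := (cr R).
Local Notation an := (an R).
Local Notation crs := (crs R).
Local Notation ans := (ans R).
Local Notation gtproj := (gtproj R).
Implicit Types (p q : seq int) (i j : int) (A B : M0) (l : {fset int}).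

Definition basisX (ll : {fset int} * {fset int}) : M0 := Xbasis R ll.1 ll.2.

Definition fset_of_seq p : {fset int} := [fset i in p]%fset.

Lemma sort_fset_of_seq p : sorted <%R p -> sort <=%R (fset_of_seq p) = p.
Proof.
move=> ps; apply: lt_sorted_eq => [|//|i]; first by rewrite sort_lt_sorted fset_uniq.
by rewrite mem_sort !inE.
Qed.

Lemma sort_fset_inj : injective (fun l => sort <=%R l).
Proof.
by move=> l1 l2 E; apply/fsetP => i; rewrite -(mem_sort <=%R l1) E mem_sort.
Qed.

Lemma sort_fset1 i : sort <=%R [fset i]%fset = [:: i].
Proof.
apply: lt_sorted_eq => [|//|j]; first by rewrite sort_lt_sorted fset_uniq.
by rewrite mem_sort !inE.
Qed.

Lemma sorted_sort_fset l : sorted <%R (sort <=%R l).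
Proof. by rewrite sort_lt_sorted fset_uniq. Qed.

Lemma basisX_gtproj i : basisX ([fset i]%fset, [fset i]%fset) = gtproj i.
Proof. exact: XbasisE1. Qed.

Lemma basisX_crs_ans l1 l2 : (forall i, (l1, l2) != ([fset i], [fset i])%fset) ->
  basisX (l1, l2) = crs (sort <=%R l1) * ans (sort <=%R l2).
Proof.
rewrite /basisX /Xbasis /= => lN; case: ifP => // /andP[/eqP ll /cardfs1P[i li]].
by have := lN i; rewrite -ll li eqxx.
Qed.

Lemma basisX_case (Q : M0 -> Prop) : (forall p q, Q (crs p * ans q)) ->
  (forall i, Q (gtproj i)) -> forall ll, Q (basisX ll).
Proof.
move=> Qpq Qi [l1 l2]; have [[i lE]|lN] := pselect (exists i,
  (l1, l2) = ([fset i], [fset i])%fset); first by rewrite lE basisX_gtproj.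
by rewrite basisX_crs_ans// => i; apply/eqP => lE; case: lN; exists i.
Qed.

Lemma in_span_gtproj i : in_span basisX (gtproj i).
Proof. by rewrite -basisX_gtproj; exact: in_span_vec. Qed.

Lemma crs1 i : crs [:: i] = cr i. Proof. exact: big_seq1. Qed.
Lemma ans1 i : ans [:: i] = an i. Proof. exact: big_seq1. Qed.

(** The only nonzero words in normal form that are not basis elements are the
    [cr i * an i], and each of these is a difference of two basis elements. *)
Lemma in_span_crs_ans p q : in_span basisX (crs p * ans q).
Proof.
have [ps|/crs_unsorted->] := boolP (sorted <%R p); last first.
  by rewrite mul0r; exact: in_span0.
have [qs|/ans_unsorted->] := boolP (sorted <%R q); last first.
  by rewrite mulr0; exact: in_span0.
have [[i pqE]|pqN] := pselect (exists i, (p, q) = ([:: i], [:: i])).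
  case: pqE => -> ->; rewrite crs1 ans1.
  have -> : cr i * an i = gtproj (i - 1) - gtproj i.
    by rewrite (gtproj_succ R (i - 1)) subrK addrAC subrr add0r.
  by apply: in_spanB; exact: in_span_gtproj.
rewrite -(sort_fset_of_seq ps) -(sort_fset_of_seq qs) -basisX_crs_ans.
  exact: in_span_vec.
move=> i; apply/eqP => -[pE qE]; apply: pqN; exists i.
by rewrite -(sort_fset_of_seq ps) -(sort_fset_of_seq qs) pE qE sort_fset1.
Qed.

Lemma in_span_crs p : in_span basisX (crs p).
Proof. by rewrite -[crs p]mulr1 -(ans_nil R); exact: in_span_crs_ans. Qed.

Lemma in_span_ans q : in_span basisX (ans q).
Proof. by rewrite -[ans q]mul1r -(crs_nil R); exact: in_span_crs_ans. Qed.

(** For [j <= i] the projection acts trivially next to [cr i]; from there its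
    threshold is raised one unit at a time, and each unit costs one word in
    normal form. *)
Lemma in_span_cr_gtproj i j : in_span basisX (cr i * gtproj j).
Proof.
have base k : k <= i -> in_span basisX (cr i * gtproj k).
  by move=> ki; rewrite mul_cr_gtproj// -crs1; exact: in_span_crs.
have [/base//|/ltW ij] := leP j i.
have -> : j = i + `|j - i|%N :> int by lia.
elim: `|j - i|%N => [|n IH]; first by apply: base; rewrite addr0.
have -> : cr i * gtproj (i + n.+1) = cr i * gtproj (i + n) -
    crs [:: i; i + n.+1] * ans [:: i + n.+1].
  rewrite crs_cons crs1 ans1 (gtproj_succ R (i + n)).
  have -> : i + n + 1 = i + n.+1 :> int by lia.
  by rewrite mulrDr mulrA addrK.
apply: in_spanB => //; exact: in_span_crs_ans.
Qed.

(** The same induction, now starting from thresholds up to the last index of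
    [q], which is the leftmost annihilator of [ans q]. *)
Lemma in_span_gtproj_ans i q : in_span basisX (gtproj i * ans q).
Proof.
case/lastP: q => [|q j]; first by rewrite ans_nil mulr1; exact: in_span_gtproj.
have base k : k <= j -> in_span basisX (gtproj k * ans (rcons q j)).
  move=> kj; rewrite ans_rcons mulrA mul_gtproj_an// -ans_rcons.
  exact: in_span_ans.
have [/base//|/ltW ji] := leP i j.
have -> : i = j + `|i - j|%N :> int by lia.
elim: `|i - j|%N => [|n IH]; first by apply: base; rewrite addr0.
have -> : gtproj (j + n.+1) * ans (rcons q j) =
    gtproj (j + n) * ans (rcons q j) -
    crs [:: j + n.+1] * ans (rcons (rcons q j) (j + n.+1)).
  rewrite (ans_rcons R (j + n.+1)) crs1 (gtproj_succ R (j + n)).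
  have -> : j + n + 1 = j + n.+1 :> int by lia.
  by rewrite mulrDl mulrA addrK.
apply: in_spanB => //; exact: in_span_crs_ans.
Qed.

Lemma in_span_cr_basisX i ll : in_span basisX (cr i * basisX ll).
Proof.
apply: (basisX_case (Q := fun A => in_span basisX (cr i * A))) => [p q|j].
  by rewrite mulrA -crs_cons; exact: in_span_crs_ans.
exact: in_span_cr_gtproj.
Qed.

Lemma in_span_an_basisX i ll : in_span basisX (an i * basisX ll).
Proof.
apply: (basisX_case (Q := fun A => in_span basisX (an i * A))) => [[|j p] q|j].
- by rewrite crs_nil mul1r -ans_rcons; exact: in_span_ans.
- rewrite crs_cons -mulrA mulrA; have [<-|ij] := eqVneq i j; last first.
    by rewrite mul_an_cr// mul0r; exact: in_span0.
  rewrite -/(gtproj i); case: p => [|k p].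
    by rewrite crs_nil mul1r; exact: in_span_gtproj_ans.
  have [ik|ki] := ltP i k.
    rewrite crs_cons -mulrA mulrA mul_gtproj_cr// mulrA -crs_cons.
    exact: in_span_crs_ans.
  rewrite /gtproj mulrA -[an i * _ * _]mulrA -crs_cons crs_unsorted.
    by rewrite mulr0 mul0r; exact: in_span0.
  by rewrite /= ltNge ki.
- have [ji|ij] := ltP j i.
    by rewrite mul_an_gtproj// -ans1; exact: in_span_ans.
  rewrite /gtproj mulrA -(ans1 j) -ans_rcons ans_unsorted; last first.
    by rewrite /= ltNge ij.
  by rewrite mul0r; exact: in_span0.
Qed.

Lemma mull_linear A : linear (fun B => A * B : M0).
Proof. by move=> c B C; rewrite mulrDr scalerAr. Qed.

Lemma in_span_cr A i : in_span basisX A -> in_span basisX (cr i * A).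
Proof.
move=> [s ->]; apply: (in_span_map s (@mull_linear (cr i))) => ll.
exact: in_span_cr_basisX.
Qed.

Lemma in_span_an A i : in_span basisX A -> in_span basisX (an i * A).
Proof.
move=> [s ->]; apply: (in_span_map s (@mull_linear (an i))) => ll.
exact: in_span_an_basisX.
Qed.

Lemma in_span_mul A B :
  in_span basisX A -> in_span basisX B -> in_span basisX (A * B).
Proof.
have crs_mul p C : in_span basisX C -> in_span basisX (crs p * C).
  elim: p => [|i p IH] sC; first by rewrite crs_nil mul1r.
  by rewrite crs_cons -mulrA; apply: in_span_cr; exact: IH.
have ans_mul q C : in_span basisX C -> in_span basisX (ans q * C).
  elim/last_ind: q => [|q i IH] sC; first by rewrite ans_nil mul1r.
  by rewrite ans_rcons -mulrA; apply: in_span_an; exact: IH.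
move=> [s ->] sB.
apply: (in_span_map (f := fun C => C * B)) => [c C D|ll].
  by rewrite mulrDl scalerAl.
apply: (basisX_case (Q := fun A => in_span basisX (A * B))) => [p q|i].
  by rewrite -mulrA; apply/crs_mul/ans_mul.
by rewrite /gtproj -mulrA; apply/in_span_an/in_span_cr.
Qed.

End Spanning.

(** * The elements X span the whole star-algebra *)

Section FiniteSupport.
Variables (R : realType) (I : pointedType).
Implicit Types (x y z : l2 R I).

Definition finitely_supported x :=
  exists F : {fset I}, forall i, i \notin F -> x i = 0.

(** The partial sums are constant along the finite sets containing [F]. *)
Lemma inner_finE x y (F : {fset I}) : (forall i, i \notin F -> x i = 0) ->
  inner x y = \sum_(i <- F) x i * (y i)^*.
Proof.
move=> xF; rewrite /inner /summability.sum.
refine (@lim_near_cst _ (@norm_hausdorff _ R[i]^o) _ _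
  summability.totally_filter _ _ _).
refine (ex_intro2 _ _ F Logic.I _) => G /= FG.
rewrite /summability.partial_sum.
rewrite -(big_seq_fsetE _ G xpredT (fun i => x i * (y i)^*)) /=.
rewrite [LHS](big_fsetID _ (mem F)) /= [X in _ + X]big1_seq ?addr0; last first.
  by move=> i /andP[_]; rewrite !inE => /andP[_ iF]; rewrite xF ?mul0r.
congr (\sum_(i <- enum_fset _) _); apply/fsetP => i; rewrite !inE.
by apply: andb_idl => iF; exact: (fsubsetP FG).
Qed.

Lemma inner_lin c x y z : finitely_supported x -> finitely_supported y ->
  inner (c *: x + y) z = c * inner x z + inner y z.
Proof.
move=> [F xF] [G yG].
have xFG i : i \notin (F `|` G)%fset -> x i = 0.
  by rewrite inE negb_or => /andP[iF _]; exact: xF.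
have yFG i : i \notin (F `|` G)%fset -> y i = 0.
  by rewrite inE negb_or => /andP[_ iG]; exact: yG.
have xyE i : (c *: x + y) i = c * x i + y i by [].
rewrite (inner_finE _ xFG) (inner_finE _ yFG) (@inner_finE _ _ (F `|` G)%fset).
  rewrite mulr_sumr -big_split; apply: eq_bigr => i _.
  by rewrite xyE mulrDl mulrA.
by move=> i iFG; rewrite xyE xFG// yFG// mulr0 addr0.
Qed.

Lemma finitely_supported_lin c x y :
  finitely_supported x -> finitely_supported y ->
  finitely_supported (c *: x + y).
Proof.
move=> [F xF] [G yG]; exists (F `|` G)%fset => i.
rewrite inE negb_or => /andP[iF iG].
by rewrite -[LHS]/(c * x i + y i) xF// yG// mulr0 addr0.
Qed.

Lemma basisE (i j : I) : basis R i j = (j == i)%:R.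
Proof. by []. Qed.

Lemma inner_basis i x : inner (basis R i) x = (x i)^*.
Proof.
rewrite (@inner_finE _ _ [fset i]%fset).
  by rewrite big_seq_fset1 basisE eqxx mul1r.
by move=> j; rewrite inE basisE => /negbTE ->.
Qed.

Lemma adjoint_mul (A A' B B' : bop R I) :
  adjoint A A' -> adjoint B B' -> adjoint (A * B) (B' * A').
Proof. by move=> AA BB x y; rewrite -[LHS]/(inner (A (B x)) y) AA BB. Qed.

End FiniteSupport.

Section StarClosure.
Variable R : realType.
Local Notation M0 := (M0 R).
Implicit Types (A B : M0) (t u : mono).

(** [A'] is the adjoint of [A] as seen by the basis vectors, which [A] maps to
    finitely supported vectors. All the sums involved are finite, so this
    relation is additive without any convergence argument, and it still
    determines [A']. *)
Definition row_adjoint A A' := forall t,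
  finitely_supported (A (basis R t)) /\
  forall y, inner (A (basis R t)) y = (A' y t)^*.

(** The coordinates of [B y] are the conjugates of the inner products of the
    [A (basis R t)] with [y]. *)
Lemma row_adjoint_unique A A' (B : bfock R) :
  row_adjoint A A' -> adjoint (M0_val A) B -> B = M0_val A'.
Proof.
move=> AA' AB; apply: bopP => y; apply/val_inj/funext => t; apply/eqP.
rewrite -(inj_eq (can_inj conjCK)); apply/eqP.
have [_ /(_ y)] := AA' t.
rewrite -[M0_fun _ _]/(bop_fun (M0_val A) (basis R t)) AB.
by rewrite inner_basis.
Qed.

Lemma row_adjoint_lin c A A' B B' : row_adjoint A A' -> row_adjoint B B' ->
  row_adjoint (c *: A + B) (c^* *: A' + B').
Proof.
move=> AA BB t; have [fA AE] := AA t; have [fB BE] := BB t; split.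
  exact: (finitely_supported_lin c fA fB).
move=> y; rewrite addM0E scaleM0E rmorphD rmorphM /= conjCK -AE -BE.
exact: inner_lin.
Qed.

Lemma adjoint_row_adjoint A A' :
  (forall t, finitely_supported (A (basis R t))) ->
  adjoint (M0_val A) (M0_val A') -> row_adjoint A A'.
Proof. by move=> fA AA t; split => // y; rewrite -inner_basis; exact: AA. Qed.

Lemma adjoint1 : adjoint (1 : bfock R) 1.
Proof. by []. Qed.

Lemma adjoint_crs p : adjoint (M0_val (crs R p)) (M0_val (ans R p)).
Proof.
elim: p => [|i p IH]; first by rewrite crs_nil ans_nil; exact: adjoint1.
rewrite crs_cons ans_cons; exact: (adjoint_mul (adjoint_creation i) IH).
Qed.

Lemma adjoint_ans p : adjoint (M0_val (ans R p)) (M0_val (crs R p)).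
Proof.
elim: p => [|i p IH]; first by rewrite crs_nil ans_nil; exact: adjoint1.
rewrite crs_cons ans_cons; exact: (adjoint_mul IH (adjoint_annihilation i)).
Qed.

Lemma mono_at_basis t w : mono_at (basis R t) w = (w == val t)%:R.
Proof.
have [ws|ws] := boolP (sorted <%R w); last first.
  rewrite mono_at_unsorted//; case: eqP => // wt; case/negP: ws.
  by rewrite wt; case: (t).
by rewrite -[w]/(val (Mono ws)) mono_at_val.
Qed.

Lemma row_adjoint_crs_ans p q :
  row_adjoint (crs R p * ans R q) (crs R q * ans R p).
Proof.
apply: adjoint_row_adjoint => [t|]; last first.
  exact: (adjoint_mul (adjoint_crs p) (adjoint_ans q)).
exists [fset insubd mono0 (p ++ drop (size q) t)]%fset => u.
rewrite inE crs_ansE => /eqP uN; case: ifPn => // /prefixP[w uE].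
rewrite mono_at_basis; case: eqP => // tE; case: uN; apply: val_inj.
rewrite val_insubd -tE drop_size_cat// uE drop_size_cat// -uE.
by case: u {uE tE} => u /= ->.
Qed.

Lemma row_adjoint_gtproj i : row_adjoint (gtproj R i) (gtproj R i).
Proof.
apply: adjoint_row_adjoint => [t|]; last first.
  exact: (adjoint_mul (adjoint_annihilation i) (adjoint_creation i)).
exists [fset t]%fset => u; rewrite inE gtprojE => /negbTE ut.
by rewrite basisE ut if_same.
Qed.

Lemma in_span_row_adjoint A : in_span (basisX R) A ->
  exists2 A', in_span (basisX R) A' & row_adjoint A A'.
Proof.
case=> s ->; elim: s => [|[c ll] s [A' sA' AA']].
  exists 0; first exact: in_span0.
  rewrite /lincomb big_nil => t; split; first by exists fset0.
  move=> y; rewrite (@inner_finE _ _ _ _ fset0)//.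
  by rewrite big_seq_fset0 -[M0_fun _ _ _]/(0 : R[i]) conjC0.
have [B sB XB] : exists2 B, in_span (basisX R) B & row_adjoint (basisX R ll) B.
  apply: (basisX_case (Q := fun A =>
    exists2 B, in_span (basisX R) B & row_adjoint A B)) => [p q|i].
    exists (crs R q * ans R p); [exact: in_span_crs_ans|exact: row_adjoint_crs_ans].
  exists (gtproj R i); [exact: in_span_gtproj|exact: row_adjoint_gtproj].
exists (c^* *: B + A'); first exact: in_span_lin.
by rewrite /lincomb big_cons; exact: row_adjoint_lin.
Qed.

(** The operators in the span form a unital star-subalgebra that contains the
    generators, hence all of [M0]. *)
Lemma spans_basisX : spans (basisX R).
Proof.
move=> A; suff [B sB] : exists2 B, in_span (basisX R) B & M0_val A = M0_val B.
  by move=> /val_inj ->.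
pose S := [set C : bfock R | exists2 B, in_span (basisX R) B & C = M0_val B].
have /asboolP SA := valP A; apply: (SA S); split=> [|_ [i _ <-]]; last first.
  by exists (an R i) => //; rewrite -ans1; exact: in_span_ans.
split.
- by exists 1 => //; rewrite -(crs_nil R); exact: in_span_crs.
- move=> c _ _ [B sB ->] [C sC ->]; exists (c *: B + C) => //.
  exact: in_span_lin.
- by move=> _ _ [B sB ->] [C sC ->]; exists (B * C) => //; exact: in_span_mul.
- move=> _ C [B /in_span_row_adjoint[B' sB' BB'] ->] BC.
  by exists B' => //; exact: row_adjoint_unique BC.
Qed.

End StarClosure.

(** * Linear independence of the elements X *)

Section Independence.
Variable R : realType.
Local Notation M0 := (M0 R).
Implicit Types (A B : M0) (p q u v : seq int) (i m : int).

(** A matrix entry of [A]; the default [mono0] is only taken when [v] is not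
    increasing. *)
Definition entry u v A : R[i] := mono_at (A (basis R (insubd mono0 v))) u.

Lemma entry_lin u v c A B :
  entry u v (c *: A + B) = c * entry u v A + entry u v B.
Proof.
have E w : (c *: A + B) (basis R (insubd mono0 v)) w =
    c * A (basis R (insubd mono0 v)) w + B (basis R (insubd mono0 v)) w.
  by rewrite addM0E scaleM0E.
rewrite /entry /mono_at; case: (insub u) => [w|]; first exact: E.
by rewrite /= mulr0 addr0.
Qed.

Lemma entry_crs_ans p q u v : sorted <%R u -> sorted <%R v ->
  entry u v (crs R p * ans R q) = (prefix p u && (v == q ++ drop (size p) u))%:R.
Proof.
move=> us vs; rewrite /entry -[u]/(val (Mono us)) mono_at_val crs_ansE mono_at_basis.
by rewrite val_insubd vs eq_sym; case: prefix.
Qed.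

Lemma entry_gtproj i u v : sorted <%R u -> sorted <%R v ->
  entry u v (gtproj R i) = (sorted <%R (i :: u) && (u == v))%:R.
Proof.
move=> us vs; rewrite /entry -[u in LHS]/(val (Mono us)) mono_at_val gtprojE basisE.
by rewrite -(inj_eq val_inj) val_insubd vs; case: ifP.
Qed.

Definition same_last u v := [&& u != [::], v != [::] & last 0 u == last 0 v].
Definition drop_last u := take (size u).-1 u.

Lemma drop_last_rcons u i : drop_last (rcons u i) = u.
Proof. by rewrite /drop_last size_rcons /= -cats1 take_size_cat. Qed.

(** Among the words in normal form, this is the linear form dual to the one
    with creators [u] and annihilators [v]. The entry at [(u, v)] of a word is
    1 when [u] and [v] arise from its creators and annihilators by appending a
    common suffix, and 0 otherwise; the nonempty suffixes already count at
    [(drop_last u, drop_last v)]. *)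
Definition psi u v A := entry u v A -
  (if same_last u v then entry (drop_last u) (drop_last v) A else 0).

Lemma psi_lin u v c A B : psi u v (c *: A + B) = c * psi u v A + psi u v B.
Proof.
rewrite /psi entry_lin; case: ifP => _; last by rewrite !subr0.
by rewrite entry_lin mulrBr opprD addrACA.
Qed.

Lemma sorted_drop_last u : sorted <%R u -> sorted <%R (drop_last u).
Proof.
move=> us; apply: (@sorted_catl _ (drop (size u).-1 u)).
by rewrite cat_take_drop.
Qed.

Lemma prefix_rconsE p u i : prefix p (rcons u i) = (p == rcons u i) || prefix p u.
Proof.
apply/idP/orP => [/prefixP[w]|[/eqP->|pu]]; last 2 first.
- exact: prefix_refl.
- by rewrite -cats1 prefix_catl.
case/lastP: w => [|w j]; first by rewrite cats0 => ->; left.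
by rewrite -rcons_cat => /rcons_inj[-> _]; right; apply: prefix_prefix.
Qed.

Lemma psi_crs_ans p q u v : sorted <%R u -> sorted <%R v ->
  psi u v (crs R p * ans R q) = ((p == u) && (q == v))%:R.
Proof.
move=> us vs; rewrite /psi !entry_crs_ans ?sorted_drop_last//.
have [uv|uvN] := boolP (same_last u v).
  case/lastP: u us uv => [//|u i] us; case/lastP: v vs => [|v j] vs /and3P[]//.
  rewrite !last_rcons => _ _ /eqP ij; rewrite -{j}ij in vs *.
  rewrite !drop_last_rcons prefix_rconsE.
  have [->|pu] /= := eqVneq p (rcons u i).
    rewrite drop_size cats0 eq_sym.
    have -> : prefix (rcons u i) u = false.
      by apply/negbTE/negP => /size_prefix; rewrite size_rcons ltnn.
    by rewrite subr0.
  have [/size_prefix pu'|_] /= := boolP (prefix p u); last by rewrite subr0.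
  by rewrite drop_rcons// -rcons_cat (inj_eq (@rcons_injl _ i)) subrr.
rewrite subr0; congr (_ : bool)%:R.
apply/andP/andP => [[/prefixP[r uE] /eqP vE]|[/eqP-> /eqP->]]; last first.
  by rewrite prefix_refl drop_size cats0.
move: vE; rewrite {1}uE drop_size_cat// => vE.
case/lastP: r uE vE => [|r i] uE vE; first by rewrite uE vE !cats0 !eqxx.
case/negP: uvN; rewrite uE vE /same_last -!rcons_cat !last_rcons eqxx andbT.
by rewrite -!size_eq0 !size_rcons.
Qed.

Lemma psi_gtproj_eq0 i u v : sorted <%R u -> sorted <%R v ->
  (1 < size u)%N || (u != v) -> psi u v (gtproj R i) = 0.
Proof.
move=> us vs; rewrite /psi !entry_gtproj ?sorted_drop_last//.
case/lastP: u us => [|u a] us; first by case: v vs => //= *; rewrite subr0.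
case/lastP: v vs => [|v b] vs.
  by rewrite /same_last andbF subr0 -size_eq0 size_rcons andbF.
rewrite !drop_last_rcons eqseq_rcons size_rcons /same_last !last_rcons.
rewrite -!size_eq0 !size_rcons /=.
case: (a == b); last by rewrite !andbF subr0.
rewrite !andbT; case: (u == v); last by rewrite !andbF subrr.
case: u us => [//|k u] /= kua _; rewrite kua !andbT.
rewrite (_ : path <%R k u) ?andbT ?subrr//.
by move: kua; rewrite rcons_path => /andP[].
Qed.

Lemma psi_gtproj1 i m : psi [:: m] [:: m] (gtproj R i) = - (m <= i)%R%:R.
Proof.
rewrite /psi !entry_gtproj//= /same_last !eqxx /= !andbT ltNge.
by case: (m <= i); rewrite /= ?sub0r ?subrr ?oppr0.
Qed.

Lemma fsetpair_eq (l1 l2 k1 k2 : {fset int}) :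
  ((l1, l2) == (k1, k2)) =
  (sort <=%R l1 == sort <=%R k1) && (sort <=%R l2 == sort <=%R k2).
Proof. by rewrite xpair_eqE !(inj_eq sort_fset_inj). Qed.

(** On [gtproj i] the form [psi [:: m] [:: m]] is [- (m <= i)], a step function
    of [m] whose difference isolates [i = m]. *)
Lemma dual_single m ll :
  psi [:: m + 1] [:: m + 1] (basisX R ll) - psi [:: m] [:: m] (basisX R ll) =
  (ll == ([fset m], [fset m]))%fset%:R.
Proof.
case: ll => l1 l2; have [[i lE]|lN] := pselect (exists i,
  (l1, l2) = ([fset i], [fset i])%fset).
  rewrite lE basisX_gtproj !psi_gtproj1 fsetpair_eq !sort_fset1 andbb.
  rewrite eqseq_cons eqxx andbT opprK; case: (ltgtP i m) => im.
  - by rewrite (_ : (m + 1 <= i) = false) ?oppr0 ?add0r//; lia.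
  - by rewrite (_ : (m + 1 <= i) = true) ?addNr//; lia.
  - by rewrite (_ : (m + 1 <= i) = false) ?oppr0 ?add0r//; lia.
have lN' i : (sort <=%R l1 == [:: i]) && (sort <=%R l2 == [:: i]) = false.
  rewrite -(sort_fset1 i) -fsetpair_eq.
  by apply/negbTE/eqP => lE; apply: lN; exists i.
rewrite basisX_crs_ans => [|i]; last by rewrite fsetpair_eq sort_fset1 lN'.
by rewrite !psi_crs_ans// !lN' fsetpair_eq sort_fset1 lN' subrr.
Qed.

Lemma dual_multi (l1 l2 : {fset int}) ll : (1 < #|` l1|)%N || (l1 != l2) ->
  psi (sort <=%R l1) (sort <=%R l2) (basisX R ll) = (ll == (l1, l2))%:R.
Proof.
move=> l12.
have l12s : (1 < size (sort <=%R l1))%N || (sort <=%R l1 != sort <=%R l2).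
  by rewrite size_sort (inj_eq sort_fset_inj).
have lN i : (([fset i], [fset i])%fset == (l1, l2)) = false.
  apply/negbTE; apply: contraL l12; rewrite xpair_eqE => /andP[/eqP<- /eqP<-].
  by rewrite cardfs1 eqxx.
case: ll => k1 k2; have [[i lE]|kN] := pselect (exists i,
  (k1, k2) = ([fset i], [fset i])%fset).
  by rewrite lE lN basisX_gtproj psi_gtproj_eq0// sorted_sort_fset.
rewrite basisX_crs_ans; last by move=> i; apply/eqP => kE; apply: kN; exists i.
by rewrite psi_crs_ans ?sorted_sort_fset// fsetpair_eq.
Qed.

(** None of the forms above is dual to the identity, the element indexed by two
    empty sets; but once all the other coefficients vanish, its coefficient
    vanishes too. *)
Lemma independent_basisX : independent (basisX R).
Proof.
move=> s s0.
have coef0 ll : ll != (fset0, fset0) -> coef s ll = 0.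
  case: ll => l1 l2 l0.
  have [l12|] := boolP ((1 < #|` l1|)%N || (l1 != l2)).
    apply: (dual_coef_eq0 (psi_lin (sort <=%R l1) (sort <=%R l2)) _ s0) => ll.
    exact: dual_multi.
  rewrite negb_or -leqNgt negbK => /andP[l11 /eqP l12].
  rewrite -{l2}l12 in l0 *.
  have /cardfs1P[m ->] : (#|` l1| == 1)%N.
    by rewrite eqn_leq l11 lt0n cardfs_eq0; apply: contra l0 => /eqP->.
  pose f A := psi [:: m + 1] [:: m + 1] A - psi [:: m] [:: m] A.
  have f_lin c A B : f (c *: A + B) = c * f A + f B.
    by rewrite /f !psi_lin [X in _ = X + _]mulrBr opprD addrACA.
  by apply: (dual_coef_eq0 f_lin _ s0) => ll; exact: dual_single.
move=> ll; have [->|/coef0//] := eqVneq ll (fset0, fset0).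
have := s0; rewrite (lincomb_single _ coef0) /basisX /= XbasisE0 => /eqP.
by rewrite scaler_eq0 oner_eq0 orbF => /eqP.
Qed.

End Independence.

(** * Exchangeable elements *)

Lemma Tsigma_permutes (R : realType) sigma :
  permutes_Xbasis sigma (@Tsigma R sigma).
Proof.
rewrite /Tsigma; case: pselect => [exT|[]]; first exact: projT2 (cid exT).
have [T TX] := linear_extension (@independent_basisX R) (@spans_basisX R)
  (fun ll => if increasing_on sigma ll.1 && increasing_on sigma ll.2
  then basisX R (sigma @` ll.1, sigma @` ll.2)%fset else 0).
by exists T => l1 l2; exact: (TX (l1, l2)).
Qed.

(** Exchanges the blocks [-N, N] and [N + 1, 3N + 1]. *)
Definition block_swap (N i : int) : int :=
  if (- N <= i) && (i <= N) then i + (2 * N + 1)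
  else if (N < i) && (i <= 3 * N + 1) then i - (2 * N + 1) else i.

Lemma block_swapK (N : int) : involutive (block_swap N).
Proof. by move=> i; rewrite /block_swap; repeat (case: ifPn); lia. Qed.

Lemma block_swap_finitary (N : int) : finitary_perm (block_swap N).
Proof.
split; first by exists (block_swap N); exact: block_swapK.
pose f (n : nat) : int := n%:Z - N.
apply: (@sub_finite_set _ _ (f @` `I_(`|(4 * N + 2)%R|%N).+1)); last first.
  exact/finite_image/finite_II.
move=> i /=; rewrite /block_swap /f => /eqP iN; exists `|(i + N)%R|%N.
  by move: iN; repeat (case: ifPn); lia.
by move: iN; repeat (case: ifPn); lia.
Qed.

Lemma block_swap_increasing (N : int) (l : {fset int}) :
  (forall i, i \in l -> `|i| <= N) -> increasing_on (block_swap N) l.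
Proof.
move=> lN; apply/asboolP => i j /lN iN /lN jN ij.
by rewrite /block_swap; repeat (case: ifPn); lia.
Qed.

(** The images of the indices in [-N, N] all lie outside [-N, N]. *)
Lemma block_swap_disjoint (N : int) (k l : {fset int}) :
    (forall i, i \in k -> `|i| <= N) -> (forall i, i \in l -> `|i| <= N) ->
  (block_swap N @` k)%fset = l -> l = fset0.
Proof.
move=> kN lN kl; apply/fsetP => i; rewrite inE; apply/negbTE/negP => il.
have := lN _ il; move: il; rewrite -kl => /imfsetP[j /= /kN jN ->].
by rewrite /block_swap; repeat (case: ifPn); lia.
Qed.

Lemma supports_bounded (t : seq ({fset int} * {fset int})) : exists N : int,
  forall l1 l2, (l1, l2) \in t ->
    (forall i, i \in l1 -> `|i| <= N) /\ (forall i, i \in l2 -> `|i| <= N).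
Proof.
pose N : int :=
  \sum_(ll <- t) \sum_(i <- (ll.1 : seq int) ++ (ll.2 : seq int)) `|i|.
exists N => l1 l2 lt.
have bound i : i \in (l1 : seq int) ++ (l2 : seq int) -> `|i| <= N.
  move=> il; rewrite /N (big_rem (l1, l2))//= (big_rem i)//= -addrA lerDl.
  by rewrite addr_ge0//; apply: sumr_ge0 => // *; exact: sumr_ge0.
by split=> i il; apply: bound; rewrite mem_cat il ?orbT.
Qed.

Theorem proposition3p3 (R : realType) :
  M0ex R = [set (c *: 1 : M0 R) | c in [set: R[i]]].
Proof.
apply/seteqP; split => [A Aex|_ [c _ <-] sigma _]; last first.
  have := @Tsigma_permutes R sigma fset0 fset0.
  have inc0 : increasing_on sigma fset0 by apply/asboolP => i.
  by rewrite linearZ /= inc0 imfset0 XbasisE0 => ->.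
have [s AE] := spans_basisX A.
have [N sN] := supports_bounded [seq cp.2 | cp <- s].
pose sigma := block_swap N.
pose shift (ll : {fset int} * {fset int}) := (sigma @` ll.1, sigma @` ll.2)%fset.
pose s' := [seq (cp.1, shift cp.2) | cp <- s].
have TA : Tsigma R sigma A = lincomb (basisX R) s'.
  rewrite AE linear_lincomb [RHS]big_map; apply: eq_big_seq => -[c [l1 l2]] cps.
  have /sN[l1N l2N] : (l1, l2) \in [seq cp.2 | cp <- s].
    by apply/mapP; exists (c, (l1, l2)).
  by rewrite [Tsigma _ _ _]Tsigma_permutes !block_swap_increasing.
have ss' : coef s =1 coef s'.
  apply: (independent_coef (@independent_basisX R)).
  by rewrite -AE -TA Aex//; exact: block_swap_finitary.
exists (coef s (fset0, fset0)) => //.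
rewrite AE (@lincomb_single _ _ _ _ _ (fset0, fset0)).
  by rewrite /basisX XbasisE0.
move=> [l1 l2] l0.
have [ls|] := boolP ((l1, l2) \in [seq cp.2 | cp <- s]); last exact: coef_notin.
(* an index of [s] that is also one of [s'] has both components in [-N, N] and
   outside it, hence empty *)
rewrite ss'; apply: coef_notin; apply: contra l0.
move=> /mapP[cp /mapP[cq cqs ->]] /=; have [l1N l2N] := sN _ _ ls.
move=> [l1E l2E]; have /sN[k1N k2N] : (cq.2.1, cq.2.2) \in [seq cp.2 | cp <- s].
  by rewrite -surjective_pairing map_f.
rewrite (block_swap_disjoint k1N l1N (esym l1E)).
by rewrite (block_swap_disjoint k2N l2N (esym l2E)).
Qed.
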